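(* Let $n\ge 1$ be an integer, let $f_n(x)=\sqrt{\frac{\pi}{2}}\,x^{n+\frac12}J_{n+\frac12}(x)$ for $x>0$, and let $$w(f_n)=\det\begin{pmatrix} f_n'' & f_n' & f_n\\ f_n^{(3)} & f_n'' & f_n'\\ f_n^{(4)} & f_n^{(3)} & f_n''\end{pmatrix}.$$ Then the functions $x\mapsto x^{-3(n-1)}w(f_n)(x)$ and $x\mapsto w(f_n)(x)$ are increasing and positive on the interval $(0,j_1(f_n'))$. Moreover, $w(f_n)$ is positive on $(0,j_1(f_n))$.
   Context: $J_\nu$ denotes the Bessel function of the first kind, $J_\nu(x)=\sum_{k=0}^\infty \frac{(-1)^k}{\Gamma(k+1)\Gamma(k+\nu+1)}\left(\frac{x}{2}\right)^{2k+\nu}$. For a function $g$ on $(0,\infty)$, $j_1(g)$ denotes the first positive zero of $g$; in particular $j_1(f_n)=j_{n+\frac12,1}$, the first positive zero of $J_{n+\frac12}$, and $j_1(f_n')$ is the first positive zero of the derivative $f_n'$. *)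

(* Defs.v *)
From mathcomp Require Import all_boot all_algebra.
From mathcomp Require Import Rstruct.
From Stdlib Require Import Reals ZArith.
From Coquelicot Require Import Coquelicot.

Set Implicit Arguments.
Unset Strict Implicit.
Unset Printing Implicit Defensive.

Local Open Scope ring_scope.

(* The entry in row i and column j, counted from 0, is the derivative of order
   2 + i - j; this natural-number subtraction never truncates, since j <= 2. *)
Definition w3 (g : R -> R) (x : R) : R :=
  \det (\matrix_(i < 3, j < 3) Derive_n g (2 + i - j)%nat x).

Local Close Scope ring_scope.
Local Open Scope R_scope.

(* Euler's integral of the second kind, as an improper Riemann integral; it is
   the Gamma function for 0 < s, and carries no meaning for s <= 0. *)
Definition Gamma (s : R) : R :=
  RInt_gen (fun t => Rpower t (s - 1) * exp (- t))
           (at_right 0) (Rbar_locally p_infty).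

(* The Bessel function of the first kind, for -1 < nu and 0 < x: in that range
   every argument of Gamma and the base of Rpower are positive. *)
Definition BesselJ (nu x : R) : R :=
  Series (fun k : nat =>
    (-1) ^ k / (Gamma (INR k + 1) * Gamma (INR k + nu + 1))
    * Rpower (x / 2) (2 * INR k + nu)).

Definition is_first_positive_zero (g : R -> R) (a : R) : Prop :=
  0 < a /\ g a = 0 /\ (forall x, 0 < x -> x < a -> g x <> 0).

(* iota is Coquelicot's definite description: j1 g satisfies
   is_first_positive_zero g as soon as g has a first positive zero, which is
   then unique; otherwise j1 g is unspecified. *)
Definition j1 (g : R -> R) : R :=
  Hierarchy.iota (T := R_CompleteNormedModule) (is_first_positive_zero g).

Definition bessel_f (n : nat) (x : R) : R :=
  sqrt (PI / 2) * Rpower x (INR n + 1 / 2) * BesselJ (INR n + 1 / 2) x.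

Definition positive_on (h : R -> R) (a b : R) : Prop :=
  forall x, a < x -> x < b -> 0 < h x.

Definition increasing_on (h : R -> R) (a b : R) : Prop :=
  forall x y, a < x -> x < y -> y < b -> h x < h y.

(* Main.v *)
(** Euler's functional equation of Gamma identifies [bessel_f n x], up to a
    positive constant, with [x^(2n+1) * core n x], where [core n] is an even
    entire function satisfying [(core n)' = - x core (n+1)] and a three-term
    recurrence.  For [n = m+1] write [A = core m], [B = core (m+1)]; then
    [f' ~ x^(2m+2) A], and [w(f) ~ x^(6m+3) W] for a polynomial [W] in [x^2],
    [A], [B].  The key identities are
    - [(x^(3m+3) W)' = x^(3m+2) A G];
    - [(x^(2m) G)' = 3(m+1)m x^(2m-1) T];
    - [(x^(2m+3) T)' = 2 x^(2m+2) A^2],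
    where [T] is the Turan determinant.  Read from bottom to top they give
    [T > 0], [G > 0], and monotonicity of [x^(-3m) w ~ x^(3m+3) W] as long as
    [A > 0].  Up to the first zero of [B], the quotient [A / (x^2 B)] decreases,
    so either [A > 0] on [(0, x]], or [A x <= 0] and every term of [W] is
    nonnegative, the last one being positive. *)

From mathcomp Require all_boot all_algebra Rstruct.
Require Import Defs.
From Stdlib Require Import Reals ZArith Lra Lia.
From Coquelicot Require Import Coquelicot.
Local Open Scope R_scope.

(* The imports are confined to a section because MathComp redefines the
   notations of [nat_scope]. *)
Section Determinant.
Import mathcomp.boot.all_boot mathcomp.algebra.all_algebra Rstruct.
Import GRing.Theory.

(** * Expansion of the determinant *)

Lemma w3E (g : R -> R) (x : R) (D := fun k => Derive_n g k x) :
  w3 g x = D 2%nat ^ 3 - 2 * D 1%nat * D 2%nat * D 3%nat + D 1%nat ^ 2 * D 4%nat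
           + D 0%nat * D 3%nat ^ 2 - D 0%nat * D 2%nat * D 4%nat.
Proof.
rewrite /w3 (expand_det_row _ ord0).
rewrite !big_ord_recl big_ord0 /cofactor.
rewrite !(expand_det_row _ ord0) !big_ord_recl !big_ord0 /cofactor !det_mx11 !mxE.
(* The orders of differentiation and the cofactor signs are still expressions in ordinals; they are
   evaluated to numerals. *)
repeat match goal with |- context [Derive_n g ?k x] =>
  let k' := eval compute in k in change (Derive_n g k x) with (D k') end.
repeat match goal with |- context [GRing.exp (-1)%R ?k] =>
  let k' := eval compute in k in progress change (GRing.exp (-1)%R k) with (GRing.exp (-1 : R)%R k') end.
rewrite !expr0 !expr1 expr2.
clearbody D. cbn -[Rplus Rmult Rminus pow].
cbv [GRing.opp GRing.one GRing.zero]. simpl.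
ring.
Qed.

End Determinant.

(** * Monotonicity from the sign of the derivative *)

Lemma MVT_is_derive (f df : R -> R) (a b : R) :
  a < b -> (forall x, a <= x <= b -> is_derive f x (df x)) ->
  exists c, f b - f a = df c * (b - a) /\ a < c < b.
Proof.
intros Hab Hf; apply MVT_cor2; auto.
intros c Hc; apply is_derive_Reals; auto.
Qed.

Lemma derive_pos_lt (f df : R -> R) (a b : R) :
  a < b -> (forall x, a <= x <= b -> is_derive f x (df x)) ->
  (forall x, a < x < b -> 0 < df x) -> f a < f b.
Proof.
intros Hab Hf Hpos; destruct (MVT_is_derive f df a b Hab Hf) as [c [Ec Hc]].
specialize (Hpos c Hc); nra.
Qed.

Lemma derive_nonneg_le (f df : R -> R) (a b : R) :
  a <= b -> (forall x, a <= x <= b -> is_derive f x (df x)) ->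
  (forall x, a < x < b -> 0 <= df x) -> f a <= f b.
Proof.
intros [Hab|<-] Hf Hpos; [|lra].
destruct (MVT_is_derive f df a b Hab Hf) as [c [Ec Hc]].
specialize (Hpos c Hc); nra.
Qed.

(** * Improper integrals on the half-line and Euler's functional equation *)

Lemma filter_prod_pos (P : R * R -> Prop) :
  (forall a b, 0 < a -> 0 < b -> P (a, b)) ->
  filter_prod (at_right 0) (Rbar_locally p_infty) P.
Proof.
intros HP; apply Filter_prod with (fun a => 0 < a) (fun b => 0 < b).
- exists (mkposreal 1 Rlt_0_1); auto.
- exists 0; auto.
- exact HP.
Qed.

Lemma Rmin_pos_le (a b x : R) : 0 < a -> 0 < b -> Rmin a b <= x -> 0 < x.
Proof. intros; assert (0 < Rmin a b) by (apply Rmin_pos; auto); lra. Qed.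

Lemma is_RInt_gen_antiderivative (F f : R -> R) (la lb : R) :
  (forall x, 0 < x -> is_derive F x (f x)) ->
  (forall x, 0 < x -> continuous f x) ->
  filterlim F (at_right 0) (locally la) ->
  filterlim F (Rbar_locally p_infty) (locally lb) ->
  is_RInt_gen f (at_right 0) (Rbar_locally p_infty) (lb - la).
Proof.
intros HF Hf Hla Hlb.
apply is_RInt_gen_ext with (Derive F).
{ apply filter_prod_pos; simpl; intros a b Ha Hb x Hx.
  apply is_derive_unique, HF, (Rmin_pos_le a b); lra. }
apply is_RInt_gen_Derive; auto; apply filter_prod_pos; simpl;
  intros a b Ha Hb x Hx; assert (Hx0 : 0 < x) by (apply (Rmin_pos_le a b); lra).
- exists (f x); auto.
- apply continuous_ext_loc with f; auto.
  exists (mkposreal x Hx0); intros y Hy; symmetry; apply is_derive_unique, HF.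
  apply Rabs_def2 in Hy; unfold minus, plus, opp in Hy; simpl in Hy; lra.
Qed.

Definition euler (s t : R) : R := Rpower t (s - 1) * exp (- t).

Lemma continuous_euler (s t : R) : 0 < t -> continuous (euler s) t.
Proof.
intros Ht; apply (ex_derive_continuous (euler s)); unfold euler, Rpower; auto_derive; auto.
Qed.

Lemma is_lim_Rpower_0 (s : R) : 0 < s -> filterlim (fun t => Rpower t s) (at_right 0) (locally 0).
Proof.
intros Hs; unfold Rpower.
apply filterlim_comp with (Rbar_locally m_infty); [|exact is_lim_exp_m].
apply filterlim_comp with (Rbar_locally m_infty).
- exact is_lim_ln_0.
- intros P [M HM]; exists (M / s); intros y Hy; apply HM.
  apply Rmult_lt_compat_l with (r := s) in Hy; auto.
  replace (s * (M / s)) with M in Hy by (field; lra); lra.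
Qed.

(** The function is the exponential of [t * (s * (ln t / t) - 1)], and [ln t / t] tends to 0. *)
Lemma is_lim_Rpower_exp (s : R) : is_lim (fun t => Rpower t s * exp (- t)) p_infty 0.
Proof.
apply is_lim_ext_loc with (fun t => exp (t * (s * (ln t / t) - 1))).
{ exists 0; intros t Ht; unfold Rpower; rewrite <- exp_plus; f_equal; field; lra. }
apply is_lim_comp with m_infty.
- exact is_lim_exp_m.
- replace m_infty with (Rbar_mult p_infty (s * 0 - 1)).
  2:{ unfold Rbar_mult; simpl; case Rle_dec; [intros; exfalso; lra|reflexivity]. }
  apply is_lim_mult; [apply is_lim_id | | simpl; lra].
  apply (is_lim_minus _ _ _ (s * 0) 1).
  + apply (is_lim_scal_l _ s _ 0); exact is_lim_div_ln_p.
  + apply is_lim_const.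
  + reflexivity.
- exists 0; intros; discriminate.
Qed.

(** Integration by parts: [t^s e^(-t)] vanishes at both ends and its derivative is the difference of
    the two integrands. Convergence at [s + 1] is thus inherited from convergence at [s]. *)
Lemma is_RInt_gen_euler_succ (s l : R) : 0 < s ->
  is_RInt_gen (euler s) (at_right 0) (Rbar_locally p_infty) l ->
  is_RInt_gen (euler (s + 1)) (at_right 0) (Rbar_locally p_infty) (s * l).
Proof.
intros Hs Hl.
assert (H0 : is_RInt_gen (fun t => s * euler s t - euler (s + 1) t)
   (at_right 0) (Rbar_locally p_infty) (0 - 0)).
{ apply (is_RInt_gen_antiderivative (fun t => Rpower t s * exp (- t))).
  - intros t Ht; unfold euler.
    replace (Rpower t (s - 1)) with (Rpower t s / t).
    2:{ unfold Rminus; rewrite Rpower_plus, Rpower_Ropp, Rpower_1; auto. }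
    replace (s + 1 - 1) with s by ring.
    unfold Rpower; auto_derive; auto. field; lra.
  - intros t Ht; apply (continuous_minus (fun t => s * euler s t)).
    + apply (continuous_scal_r s (euler s)), continuous_euler, Ht.
    + apply continuous_euler, Ht.
  - replace (locally 0) with (locally (0 * exp (- 0))) by (f_equal; ring).
    apply (is_lim_Rpower_0 s) in Hs.
    apply (filterlim_comp_2 (H := locally (exp (- 0))) _ (fun t => exp (- t)) Rmult Hs).
    + apply (filterlim_filter_le_1 (F := locally 0)); [apply filter_le_within|].
      apply (continuous_comp Ropp exp).
      * apply (continuous_opp (fun x:R => x)), continuous_id.
      * apply continuous_exp.
    + apply (filterlim_mult (K:=R_AbsRing)).
  - apply is_lim_Rpower_exp. }
generalize (is_RInt_gen_minus _ _ _ _ (is_RInt_gen_scal _ s _ Hl) H0).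
unfold minus, plus, opp, scal; simpl; unfold mult; simpl.
replace (s * l + - (0 - 0)) with (s * l) by ring.
apply is_RInt_gen_ext, filter_prod_pos; simpl; intros; ring.
Qed.

(** * Convergence of Euler's integral at 3/2 *)

Lemma monotone_bounded_limits (F : R -> R) (M : R) :
  (forall x y, 0 < x -> x <= y -> F x <= F y) ->
  (forall x, 0 < x -> Rabs (F x) <= M) ->
  exists la lb, filterlim F (at_right 0) (locally la) /\
    filterlim F (Rbar_locally p_infty) (locally lb) /\
    forall x, 0 < x -> la <= F x <= lb.
Proof.
intros Hmon Hb.
destruct (completeness (fun y => exists x, 0 < x /\ y = F x)) as [lb [Ub Lb]].
{ exists M; intros y [x [Hx ->]]; apply Rabs_le_between, Hb, Hx. }
{ exists (F 1), 1; split; [lra|reflexivity]. }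
(* The infimum of [F], limit at 0, is obtained as minus the supremum of [- F]. *)
destruct (completeness (fun y => exists x, 0 < x /\ y = - F x)) as [la [Ua La]].
{ exists M; intros y [x [Hx ->]]; specialize (Hb x Hx); apply Rabs_le_between in Hb; lra. }
{ exists (- F 1), 1; split; [lra|reflexivity]. }
assert (Hub : forall x, 0 < x -> - la <= F x <= lb).
{ intros x Hx; split.
  - enough (- F x <= la) by lra; apply Ua; exists x; auto.
  - apply Ub; exists x; auto. }
exists (- la), lb; split; [|split; [|exact Hub]].
- apply filterlim_locally; intros eps.
  assert (Hex : exists x0, 0 < x0 /\ F x0 < - la + eps).
  { apply Classical_Prop.NNPP; intros Hn.
    assert (la <= la - eps); [|generalize (cond_pos eps); lra].
    apply La; intros y [x [Hx ->]].
    destruct (Rle_or_lt (- F x) (la - eps)) as [H|H]; auto.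
    exfalso; apply Hn; exists x; split; [auto|lra]. }
  destruct Hex as [x0 [Hx0 Hlt]].
  exists (mkposreal x0 Hx0); intros y Hy Hy0.
  apply Rabs_def2 in Hy; unfold minus, plus, opp in Hy; simpl in Hy.
  generalize (Hmon y x0 Hy0) (Hub y Hy0) ; intros H1 H2.
  apply Rabs_def1; unfold minus, plus, opp; simpl; lra.
- apply filterlim_locally; intros eps.
  assert (Hex : exists x0, 0 < x0 /\ lb - eps < F x0).
  { apply Classical_Prop.NNPP; intros Hn.
    assert (lb <= lb - eps); [|generalize (cond_pos eps); lra].
    apply Lb; intros y [x [Hx ->]].
    destruct (Rle_or_lt (F x) (lb - eps)) as [H|H]; auto.
    exfalso; apply Hn; exists x; split; [auto|lra]. }
  destruct Hex as [x0 [Hx0 Hlt]].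
  exists x0; intros y Hy.
  generalize (Hmon x0 y Hx0) (Hub y) ; intros H1 H2.
  apply Rabs_def1; unfold minus, plus, opp; simpl; lra.
Qed.

Lemma euler_pos (s t : R) : 0 < euler s t.
Proof. apply Rmult_lt_0_compat; apply exp_pos. Qed.

Lemma is_derive_RInt_euler (s x : R) :
  0 < x -> is_derive (fun y => RInt (euler s) 1 y) x (euler s x).
Proof.
intros Hx; apply is_derive_RInt with 1; [|apply continuous_euler, Hx].
exists (mkposreal x Hx); intros y Hy.
apply (RInt_correct (euler s)), ex_RInt_continuous; intros z Hz.
apply Rabs_def2 in Hy; unfold minus, plus, opp in Hy; simpl in Hy.
apply continuous_euler, (Rmin_pos_le 1 y); lra.
Qed.

(** The primitive based at 1 is increasing and bounded, hence has limits at both ends. *)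
Lemma is_RInt_gen_euler_3_2 : exists l, 0 < l /\
  is_RInt_gen (euler (3 / 2)) (at_right 0) (Rbar_locally p_infty) l.
Proof.
set (F := fun y => RInt (euler (3 / 2)) 1 y).
assert (HF : forall x, 0 < x -> is_derive F x (euler (3 / 2) x))
  by apply is_derive_RInt_euler.
assert (HF1 : F 1 = 0) by (unfold F; rewrite RInt_point; reflexivity).
assert (Hmon : forall x y, 0 < x -> x <= y -> F x <= F y).
{ intros x y Hx Hxy; apply derive_nonneg_le with (euler (3 / 2)); auto.
  - intros z Hz; apply HF; lra.
  - intros z _; left; apply euler_pos. }
(* On (0, 1] the integrand is at most 1. *)
assert (Hlow : forall x, 0 < x -> x <= 1 -> x - F x <= 1).
{ intros x Hx Hx1; replace 1 with (1 - F 1) at 1 by lra.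
  apply (derive_nonneg_le (fun x => x - F x) (fun x => 1 - euler (3/2) x)); auto.
  - intros z Hz; apply (is_derive_minus (fun x => x) F); [apply (is_derive_id (K:=R_AbsRing))|apply HF; lra].
  - intros z Hz; unfold euler, Rpower; rewrite <- exp_plus.
    enough (exp ((3 / 2 - 1) * ln z + - z) <= exp 0) by (rewrite exp_0 in H; lra).
    assert (ln z <= 0) by (rewrite <- ln_1; left; apply ln_increasing; lra).
    assert (Hle : (3 / 2 - 1) * ln z + - z <= 0) by lra.
    destruct Hle as [Hle|Hle]; [left; apply exp_increasing, Hle|rewrite Hle; lra]. }
(* For [t >= 1] the integrand is at most [t e^(-t)], which has the primitive [-(t + 1) e^(-t)]. *)
assert (Hup : forall x, 1 <= x -> F x + (x + 1) * exp (- x) <= 2 * exp (- (1))).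
{ intros x Hx; enough (- (F 1 + (1 + 1) * exp (- (1))) <= - (F x + (x + 1) * exp (- x))) by lra.
  apply (derive_nonneg_le (fun x => - (F x + (x + 1) * exp (- x)))
    (fun x => - (euler (3/2) x + (1 * exp (- x) + (x + 1) * (- 1 * exp (- x)))))); auto.
  - intros z Hz; apply (is_derive_opp (fun x => F x + (x + 1) * exp (- x))).
    apply (is_derive_plus F (fun x => (x + 1) * exp (- x))); [apply HF; lra|].
    auto_derive; auto; ring.
  - intros z Hz; unfold euler.
    generalize (exp_pos (- z)); intros He.
    assert (Rpower z (3 / 2 - 1) <= z); [|nra].
    rewrite <- (Rpower_1 z) at 2 by lra; apply Rle_Rpower; lra. }
destruct (monotone_bounded_limits F 2 Hmon) as [la [lb [Hla [Hlb Hl]]]].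
{ intros x Hx; apply Rabs_le_between.
  destruct (Rle_or_lt x 1) as [Hx1|Hx1].
  - generalize (Hlow x Hx Hx1) (Hmon x 1 Hx Hx1); lra.
  - generalize (Hup x) (Hmon 1 x Rlt_0_1) (exp_pos (- x)); intros H1 H2 H3.
    assert (He : exp (- (1)) < exp 0) by (apply exp_increasing; lra).
    rewrite exp_0 in He; specialize (H1 (Rlt_le _ _ Hx1)); specialize (H2 (Rlt_le _ _ Hx1)).
    assert (0 < (x + 1) * exp (- x)) by (apply Rmult_lt_0_compat; lra).
    lra. }
exists (lb - la); split.
- assert (F 1 < F 2).
  { apply derive_pos_lt with (euler (3 / 2)); [lra| |intros; apply euler_pos].
    intros z Hz; apply HF; lra. }
  generalize (Hl 1) (Hl 2); lra.
- apply is_RInt_gen_antiderivative with F; auto.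
  apply continuous_euler.
Qed.

(** * Gamma at positive integers and half-integers *)

Lemma Gamma_correct (s l : R) :
  is_RInt_gen (euler s) (at_right 0) (Rbar_locally p_infty) l -> Gamma s = l.
Proof. apply (is_RInt_gen_unique (V := R_CompleteNormedModule)); apply Proper_StrongProper; typeclasses eauto. Qed.

(** The Pochhammer symbol. *)
Fixpoint rising (s : R) (k : nat) : R :=
  match k with 0 => 1 | S k => (s + INR k) * rising s k end.

Lemma Gamma_rising (s l : R) (k : nat) : 0 < s ->
  is_RInt_gen (euler s) (at_right 0) (Rbar_locally p_infty) l ->
  Gamma (INR k + s) = rising s k * l.
Proof.
intros Hs Hl; apply Gamma_correct; induction k as [|k IH].
- simpl; rewrite Rplus_0_l, Rmult_1_l; exact Hl.
- replace (INR (S k) + s) with (INR k + s + 1) by (rewrite S_INR; ring).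
  replace (rising s (S k) * l) with ((INR k + s) * (rising s k * l)) by (simpl; ring).
  apply is_RInt_gen_euler_succ; auto.
  generalize (pos_INR k); lra.
Qed.

Lemma is_RInt_gen_euler_1 : is_RInt_gen (euler 1) (at_right 0) (Rbar_locally p_infty) 1.
Proof.
replace 1 with (0 - (- 1)) at 2 by ring.
apply (is_RInt_gen_antiderivative (fun t => - exp (- t))).
- intros t Ht; unfold euler; replace (1 - 1) with 0 by ring.
  rewrite Rpower_O by auto; auto_derive; auto; ring.
- apply continuous_euler.
- apply (filterlim_filter_le_1 (F := locally 0)); [apply filter_le_within|].
  replace (- 1) with (- exp (- 0)) by (rewrite Ropp_0, exp_0; ring).
  apply (ex_derive_continuous (fun t => - exp (- t))); auto_derive; auto.
- replace 0 with (- 0) by ring.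
  apply (is_lim_opp (fun t => exp (- t)) p_infty 0).
  apply (is_lim_ext_loc (fun t => Rpower t 0 * exp (- t))); [|apply is_lim_Rpower_exp].
  exists 0; intros t Ht; rewrite Rpower_O; auto; ring.
Qed.

Lemma rising_1_fact (k : nat) : rising 1 k = INR (fact k).
Proof.
induction k as [|k IH]; [reflexivity|].
rewrite fact_simpl, mult_INR, S_INR; simpl; rewrite IH; ring.
Qed.

Lemma Gamma_succ_nat (k : nat) : Gamma (INR k + 1) = INR (fact k).
Proof.
rewrite (Gamma_rising 1 1 k Rlt_0_1 is_RInt_gen_euler_1), rising_1_fact; ring.
Qed.
Lemma rising_pos (s : R) (k : nat) : 0 < s -> 0 < rising s k.
Proof.
intros Hs; induction k as [|k IH]; simpl; [lra|].
apply Rmult_lt_0_compat; auto; generalize (pos_INR k); lra.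
Qed.

(** * The entire functions [core n] *)

(** Coefficients in the variable [x^2] of [j_n(x) / x^n], where [j_n] is the spherical Bessel
    function; for [n = 0] this is [sin x / x]. *)
Definition core_coef (n k : nat) : R :=
  (- 1) ^ k / (2 ^ n * 4 ^ k * INR (fact k) * rising (3 / 2) (k + n)).

Lemma core_coef_den_pos (n k : nat) : 0 < 2 ^ n * 4 ^ k * INR (fact k) * rising (3 / 2) (k + n).
Proof.
repeat apply Rmult_lt_0_compat; try (apply pow_lt; lra).
- apply INR_fact_lt_0.
- apply rising_pos; lra.
Qed.

Lemma core_coef_neq_0 (n k : nat) : core_coef n k <> 0.
Proof.
apply Rmult_integral_contrapositive_currified; [apply pow_nonzero; lra|].
apply Rinv_neq_0_compat, Rgt_not_eq, core_coef_den_pos.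
Qed.

Ltac core_coef_field k n :=
  generalize (pos_INR k) (pos_INR n); intros;
  rewrite ?S_INR, ?plus_INR; field; repeat split;
  first [ apply Rgt_not_eq, rising_pos; lra
        | apply INR_fact_neq_0
        | apply pow_nonzero; lra
        | lra ].

Lemma core_coef_S (n k : nat) :
  core_coef n (S k) = - core_coef n k / (4 * (INR k + 1) * (INR k + INR n + 3 / 2)).
Proof.
unfold core_coef; rewrite fact_simpl, mult_INR.
replace (S k + n)%nat with (S (k + n)) by lia; simpl rising; simpl pow.
core_coef_field k n.
Qed.

Lemma core_coef_S_n (n k : nat) :
  core_coef (S n) k = core_coef n k / (2 * INR k + 2 * INR n + 3).
Proof.
unfold core_coef.
replace (k + S n)%nat with (S (k + n)) by lia; simpl rising; simpl pow.
core_coef_field k n.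
Qed.

Lemma CV_radius_core_coef (n : nat) : CV_radius (core_coef n) = p_infty.
Proof.
apply CV_radius_infinite_DAlembert; [apply core_coef_neq_0|].
apply is_lim_seq_le_le with (fun _ => 0) (fun k => / (INR k + 1)).
- intros k; split; [apply Rabs_pos|].
  generalize (pos_INR k) (pos_INR n); intros Hk Hn.
  replace (core_coef n (S k) / core_coef n k)
    with (- (/ (4 * (INR k + 1) * (INR k + INR n + 3 / 2)))).
  2:{ rewrite core_coef_S; field; repeat split; try lra; apply core_coef_neq_0. }
  rewrite Rabs_Ropp, Rabs_right.
  + apply Rinv_le_contravar; nra.
  + left; apply Rinv_0_lt_compat; nra.
- apply is_lim_seq_const.
- replace (Finite 0) with (Rbar_inv p_infty) by reflexivity.
  apply is_lim_seq_inv; [|discriminate].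
  apply (is_lim_seq_plus _ _ p_infty 1 p_infty); [apply is_lim_seq_INR|apply is_lim_seq_const|reflexivity].
Qed.

Definition core (n : nat) (x : R) : R := PSeries (core_coef n) (x ^ 2).

Lemma ex_pseries_core (n : nat) (t : R) : ex_pseries (core_coef n) t.
Proof. apply CV_radius_inside; rewrite CV_radius_core_coef; exact I. Qed.

Lemma is_derive_core (n : nat) (x : R) : is_derive (core n) x (- x * core (S n) x).
Proof.
evar_last.
- apply (is_derive_comp (PSeries (core_coef n)) (fun x => x ^ 2)).
  + apply is_derive_PSeries; rewrite CV_radius_core_coef; exact I.
  + auto_derive; auto.
- unfold core, scal; simpl; unfold mult; simpl.
  (* Differentiating in [x^2] multiplies the next series by -1/2; the chain rule contributes
     [2 x]. *)
  rewrite (PSeries_ext _ (PS_scal (- (1 / 2)) (core_coef (S n)))), PSeries_scal.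
  { match goal with |- ?a = ?b => change (@eq R a b) end; field. }
  intros k; change (INR (S k) * core_coef n (S k) = - (1 / 2) * core_coef (S n) k).
  rewrite core_coef_S, core_coef_S_n.
  generalize (pos_INR k) (pos_INR n); intros; rewrite S_INR; field; lra.
Qed.

(** The three-term recurrence of Bessel functions, compared coefficient by coefficient; the constant
    term is separate because the shifted series has none. *)
Lemma core_recurrence (n : nat) (x : R) :
  core n x = (2 * INR n + 3) * core (S n) x - x ^ 2 * core (S (S n)) x.
Proof.
unfold core; rewrite <- PSeries_incr_1, <- PSeries_scal, <- PSeries_minus.
- apply PSeries_ext; intros [|k]; unfold PS_minus, PS_plus, PS_opp, PS_scal, PS_incr_1, plus, opp, scal;
    simpl; unfold mult; simpl; rewrite !core_coef_S_n.
  + unfold zero; simpl; generalize (pos_INR n); intros; field; lra.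
  + rewrite core_coef_S, <- S_INR.
    generalize (pos_INR k) (pos_INR n); intros; rewrite !S_INR; field; lra.
- apply ex_pseries_scal; [apply Rmult_comm|apply ex_pseries_core].
- apply ex_pseries_incr_1, ex_pseries_core.
Qed.

Lemma core_0_pos (n : nat) : 0 < core n 0.
Proof.
unfold core; rewrite pow_i, PSeries_0 by lia.
unfold core_coef; simpl; apply Rdiv_lt_0_compat; [lra|].
exact (core_coef_den_pos n 0).
Qed.

Lemma sin_core (x : R) : sin x = x * core 0 x.
Proof.
(* By definition [sin x] is [x] times the sum of a series in [x^2]. *)
unfold sin; destruct (exist_sin (Rsqr x)) as [l Hl]; f_equal; symmetry.
apply is_pseries_unique, is_pseries_R.
apply is_series_ext with (fun k => sin_n k * Rsqr x ^ k); [|apply is_series_Reals, Hl].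
intros k; replace (Rsqr x) with (x ^ 2) by (unfold Rsqr; ring); f_equal.
unfold sin_n, core_coef; rewrite Nat.add_0_r; f_equal; f_equal; simpl (2 ^ 0).
induction k as [|k IH]; [simpl; ring|].
replace (2 * S k + 1)%nat with (S (S (2 * k + 1))) by lia.
rewrite !fact_simpl, !mult_INR, IH; simpl rising; simpl pow.
rewrite !S_INR, plus_INR, mult_INR; simpl; field.
Qed.

(** * From the Bessel series to [core], and the zeros of [core] *)

Lemma bessel_f_core (n : nat) : exists C, 0 < C /\
  forall x, 0 < x -> bessel_f n x = C * (x ^ (2 * n + 1) * core n x).
Proof.
destruct is_RInt_gen_euler_3_2 as [l [Hl Hint]].
exists (sqrt (PI / 2) * Rpower (/ 2) (INR n + 1 / 2) * (2 ^ n / l)); split.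
{ repeat apply Rmult_lt_0_compat.
  - apply sqrt_lt_R0; generalize PI_RGT_0; lra.
  - apply exp_pos.
  - apply pow_lt; lra.
  - apply Rinv_0_lt_compat, Hl. }
intros x Hx; unfold bessel_f, BesselJ.
rewrite (Series_ext _ (fun k => (2 ^ n / l * Rpower (x / 2) (INR n + 1 / 2)) * (core_coef n k * (x ^ 2) ^ k))).
- rewrite Series_scal_l; fold (PSeries (core_coef n) (x ^ 2)); fold (core n x).
  (* One factor [x^(n+1/2)] stands in front of the Bessel function, the other comes out of its
     series. *)
  replace (x ^ (2 * n + 1)) with (Rpower x (INR n + 1 / 2) * Rpower x (INR n + 1 / 2)).
  + change (x / 2) with (x * / 2); rewrite <- Rpower_mult_distr; [ring|auto|lra].
  + rewrite <- Rpower_plus, <- Rpower_pow by auto; f_equal.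
    rewrite plus_INR, mult_INR; simpl; field.
- intros k; rewrite Gamma_succ_nat.
  replace (INR k + (INR n + 1 / 2) + 1) with (INR (k + n) + 3 / 2) by (rewrite plus_INR; field).
  rewrite (Gamma_rising (3 / 2) l) by (auto; lra).
  rewrite Rpower_plus; replace (2 * INR k) with (INR (2 * k)) by (rewrite mult_INR; reflexivity).
  rewrite Rpower_pow by lra.
  replace ((x / 2) ^ (2 * k)) with ((x ^ 2) ^ k / 4 ^ k).
  + unfold core_coef; field; repeat split; try (apply pow_nonzero; lra); try lra.
    * apply Rgt_not_eq, rising_pos; lra.
    * apply INR_fact_neq_0.
  + rewrite pow_mult; unfold Rdiv; rewrite <- pow_inv, <- Rpow_mult_distr; f_equal; simpl; field.
Qed.

(** Rolle's theorem: as [(core n)' = - x core (n+1)], two positive zeros of [core n] enclose one of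
    [core (n+1)]. The induction starts from the zeros [k * PI] of the sine. *)
Lemma core_zeros_unbounded (n : nat) (M : R) : exists x, M < x /\ 0 < x /\ core n x = 0.
Proof.
revert M; induction n as [|n IH]; intros M.
- destruct (INR_unbounded (Rmax M 1)) as [k Hk].
  generalize (Rmax_l M 1) (Rmax_r M 1) PI2_1; intros H1 H2 H3.
  assert (Hx : INR k < INR k * PI) by nra.
  exists (INR k * PI); repeat split; try lra.
  apply Rmult_eq_reg_l with (INR k * PI); [|lra].
  rewrite <- sin_core, Rmult_0_r.
  apply sin_eq_0_1; exists (Z.of_nat k); rewrite INR_IZR_INZ; reflexivity.
- destruct (IH (Rmax M 0)) as [a [Ha [Ha0 Za]]].
  destruct (IH a) as [b [Hb [Hb0 Zb]]].
  destruct (MVT_is_derive (core n) (fun x => - x * core (S n) x) a b Hb) as [c [Ec Hc]].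
  { intros x _; apply is_derive_core. }
  generalize (Rmax_l M 0); intros HM.
  exists c; repeat split; try lra.
  rewrite Za, Zb in Ec.
  apply Rmult_eq_reg_l with (- c * (b - a)); nra.
Qed.

(** * The Turan determinant and the three derivative identities *)

(** For [m >= 1] this is [core m ^ 2 - core (m-1) * core (m+1)]; eliminating [core (m-1)] by the
    recurrence gives a form that also covers [m = 0]. *)
Definition turan (m : nat) (x : R) : R :=
  core m x ^ 2 - (2 * INR m + 1) * core m x * core (S m) x + x ^ 2 * core (S m) x ^ 2.

(** The [G] of the overview, which carries the sign of the derivative of [x^(3m+3) W] where
    [core m > 0]. *)
Definition drift (m : nat) (x : R) : R :=
  x ^ 2 * core m x ^ 2 + (x ^ 2 * core (S m) x) ^ 2
  - 2 * (INR m + 1) * x ^ 2 * core m x * core (S m) x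
  - (INR m + 1) * (INR m - 1) * core m x ^ 2
  + (INR m + 1) * INR m * core (S m) x
      * ((2 * INR m + 1) * core m x - x ^ 2 * core (S m) x).

(** The [W] of the overview: the determinant for [n = m + 1] divided by a positive constant and
    [x^(6m+3)]. *)
Definition reduced_w (m : nat) (x : R) : R :=
  - INR m * core m x ^ 3
  + (x ^ 2 + (INR m + 1) * (2 * INR m + 1)) * core m x ^ 2 * core (S m) x
  - (3 * INR m + 2) * x ^ 2 * core m x * core (S m) x ^ 2
  + x ^ 4 * core (S m) x ^ 3.

Lemma Derive_core (n : nat) (x : R) : Derive (fun y => core n y) x = - x * core (S n) x.
Proof. apply is_derive_unique, is_derive_core. Qed.

(* [auto_derive] leaves [INR (S k)] in unfolded form, as a match on [k]. *)
Ltac derive_core m x :=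
  auto_derive;
  [ repeat split; eexists; apply is_derive_core
  | repeat match goal with
    | |- context [match ?k with 0%nat => 1 | S _ => ?u end] =>
        change (match k with 0%nat => 1 | S _ => u end) with (INR (S k))
    end;
    rewrite ?Derive_core, ?(core_recurrence m x), ?S_INR, ?plus_INR, ?mult_INR; simpl; ring ].

(** Differentiation brings in [core (m+2)]; once [core m] is eliminated by the recurrence, a
    polynomial identity remains. *)
Lemma is_derive_turan (m : nat) (x : R) :
  is_derive (fun y => y ^ (2 * m + 3) * turan m y) x (2 * x ^ (2 * m + 2) * core m x ^ 2).
Proof.
replace (2 * m + 3)%nat with (S (2 * m + 2)) by lia.
unfold turan; derive_core m x.
Qed.

(** With [core 0 = sin x / x], the function [drift 0] is [sin^2 + cos^2]. *)
Lemma is_derive_drift_0 (x : R) : is_derive (drift 0) x 0.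
Proof. unfold drift; derive_core 0%nat x. Qed.

Lemma is_derive_drift (m : nat) (x : R) :
  is_derive (fun y => y ^ (2 * S m) * drift (S m) y) x
    (3 * (INR m + 2) * (INR m + 1) * x ^ (2 * m + 1) * turan (S m) x).
Proof.
replace (2 * S m)%nat with (S (2 * m + 1)) by lia.
unfold drift, turan; derive_core (S m) x.
Qed.

Lemma is_derive_reduced_w (m : nat) (x : R) :
  is_derive (fun y => y ^ (3 * m + 3) * reduced_w m y) x
    (x ^ (3 * m + 2) * core m x * drift m x).
Proof.
replace (3 * m + 3)%nat with (S (3 * m + 2)) by lia.
unfold reduced_w, drift; derive_core m x.
Qed.

(** * Positivity of [turan], [drift] and [reduced_w] *)

Lemma core_pos_near_0 (n : nat) : exists e, 0 < e /\ forall x, 0 <= x < e -> 0 < core n x.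
Proof.
assert (Hc : continuous (core n) 0).
{ apply (ex_derive_continuous (core n)); eexists; apply is_derive_core. }
destruct (Hc (fun y => 0 < y)) as [e He].
{ apply (open_gt 0), core_0_pos. }
exists e; split; [apply cond_pos|]; intros x Hx; apply He.
apply Rabs_def1; unfold minus, plus, opp; simpl; lra.
Qed.

(** The weighted function [K] vanishes at 0 and its derivative is a multiple of a square. *)
Lemma turan_pos (m : nat) (x : R) : 0 < x -> 0 < turan m x.
Proof.
intros Hx; destruct (core_pos_near_0 m) as [e [He Hpos]].
set (K := fun y => y ^ (2 * m + 3) * turan m y).
(* Up to [d] the function [core m] is positive, so [K] increases strictly; beyond [d] it may vanish,
   and only weak monotonicity is used. *)
set (d := Rmin x (e / 2)).
assert (Hd : 0 < d) by (apply Rmin_pos; lra).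
assert (Hdx : d <= x) by apply Rmin_l.
assert (Hde : d <= e / 2) by apply Rmin_r.
assert (HK : 0 < K x).
{ apply Rlt_le_trans with (K d).
  - replace 0 with (K 0) by (unfold K; rewrite pow_i by lia; ring).
    apply derive_pos_lt with (fun y => 2 * y ^ (2 * m + 2) * core m y ^ 2); auto.
    + intros y _; apply is_derive_turan.
    + intros y Hy; apply Rmult_lt_0_compat; [|apply pow_lt, Hpos; lra].
      apply Rmult_lt_0_compat; [lra|apply pow_lt; lra].
  - apply derive_nonneg_le with (fun y => 2 * y ^ (2 * m + 2) * core m y ^ 2); auto.
    + intros y _; apply is_derive_turan.
    + intros y Hy; apply Rmult_le_pos; [|apply pow2_ge_0].
      apply Rmult_le_pos; [lra|apply pow_le; lra]. }
apply Rmult_lt_reg_l with (x ^ (2 * m + 3)); [apply pow_lt, Hx|].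
rewrite Rmult_0_r; exact HK.
Qed.

(** For [m = 0] the function is constant and positive at 0. For larger [m] its product with [x^(2m)]
    vanishes at 0 and has a positive multiple of [turan] as derivative. *)
Lemma drift_pos (m : nat) (x : R) : 0 < x -> 0 < drift m x.
Proof.
intros Hx; destruct m as [|m].
- replace (drift 0 x) with (drift 0 0).
  + unfold drift; simpl; generalize (core_0_pos 0); intros; nra.
  + destruct (MVT_is_derive (drift 0) (fun _ => 0) 0 x Hx) as [c [Ec _]]; [|lra].
    intros y _; apply is_derive_drift_0.
- apply Rmult_lt_reg_l with (x ^ (2 * S m)); [apply pow_lt, Hx|].
  rewrite Rmult_0_r.
  set (K := fun y => y ^ (2 * S m) * drift (S m) y); change (0 < K x).
  replace 0 with (K 0) by (unfold K; rewrite pow_i by lia; ring).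
  apply (derive_pos_lt K (fun y => 3 * (INR m + 2) * (INR m + 1) * y ^ (2 * m + 1) * turan (S m) y)); auto.
  + intros y _; apply is_derive_drift.
  + intros y Hy; generalize (pos_INR m); intros Hm.
    repeat apply Rmult_lt_0_compat; try lra; [apply pow_lt|apply turan_pos]; lra.
Qed.

(** The derivative is a product of positive factors. Allowing [x = 0] lets positivity follow by
    comparison with the origin. *)
Lemma reduced_w_increasing (m : nat) (x y : R) :
  0 <= x -> x < y -> (forall z, 0 < z < y -> 0 < core m z) ->
  x ^ (3 * m + 3) * reduced_w m x < y ^ (3 * m + 3) * reduced_w m y.
Proof.
intros Hx Hxy Hpos.
apply (derive_pos_lt (fun z => z ^ (3 * m + 3) * reduced_w m z)
  (fun z => z ^ (3 * m + 2) * core m z * drift m z)); auto.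
- intros z _; apply is_derive_reduced_w.
- intros z Hz; repeat apply Rmult_lt_0_compat; [apply pow_lt|apply Hpos|apply drift_pos]; lra.
Qed.

Lemma reduced_w_pos (m : nat) (x : R) :
  0 < x -> (forall z, 0 < z < x -> 0 < core m z) -> 0 < reduced_w m x.
Proof.
intros Hx Hpos; apply Rmult_lt_reg_l with (x ^ (3 * m + 3)); [apply pow_lt, Hx|].
replace (x ^ (3 * m + 3) * 0) with (0 ^ (3 * m + 3) * reduced_w m 0)
  by (rewrite pow_i by lia; ring).
apply reduced_w_increasing; auto; lra.
Qed.

(* [core m x / (x^2 core (S m) x)] has derivative [- turan m x / (x^3 core (S m) x ^ 2)]. *)
Lemma core_pos_left (m : nat) (x : R) :
  (forall z, 0 < z <= x -> 0 < core (S m) z) -> 0 < core m x ->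
  forall z, 0 < z <= x -> 0 < core m z.
Proof.
intros HB HA z Hz.
assert (Hle : - (core m z / (z ^ 2 * core (S m) z)) <= - (core m x / (x ^ 2 * core (S m) x))).
{ apply (derive_nonneg_le (fun y => - (core m y / (y ^ 2 * core (S m) y)))
    (fun y => turan m y / (y ^ 3 * core (S m) y ^ 2))); [lra| |].
  - intros y Hy; assert (HBy : 0 < core (S m) y) by (apply HB; lra).
    auto_derive.
    + repeat split; try (eexists; apply is_derive_core).
      apply Rgt_not_eq, Rmult_lt_0_compat; nra.
    + rewrite !Derive_core.
      unfold turan; rewrite (core_recurrence m y); field; split; lra.
  - intros y Hy; left; apply Rdiv_lt_0_compat; [apply turan_pos; lra|].
    apply Rmult_lt_0_compat; apply pow_lt; [|apply HB]; lra. }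
assert (Hq : forall y, 0 < y <= x -> 0 < y ^ 2 * core (S m) y).
{ intros y Hy; apply Rmult_lt_0_compat; [apply pow_lt; lra|auto]. }
assert (0 < core m x / (x ^ 2 * core (S m) x)) by (apply Rdiv_lt_0_compat; [auto|apply Hq; lra]).
replace (core m z) with (core m z / (z ^ 2 * core (S m) z) * (z ^ 2 * core (S m) z)).
- apply Rmult_lt_0_compat; [lra|apply Hq, Hz].
- specialize (HB z Hz); field; split; lra.
Qed.

Lemma reduced_w_pos_before_zero (m : nat) (x : R) :
  0 < x -> (forall z, 0 < z <= x -> 0 < core (S m) z) -> 0 < reduced_w m x.
Proof.
intros Hx HB; destruct (Rlt_or_le 0 (core m x)) as [HA|HA].
- apply reduced_w_pos; auto; intros z Hz; apply (core_pos_left m x); auto; lra.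
- assert (HBx : 0 < core (S m) x) by (apply HB; lra).
  generalize (pos_INR m); intros Hm; unfold reduced_w.
  (* Exactly the terms of odd degree in [core m x] carry a minus sign, so in terms of [a >= 0] all
     signs become plus. *)
  set (a := - core m x); replace (core m x) with (- a) by (unfold a; ring).
  assert (Ha : 0 <= a) by (unfold a; lra).
  replace (- INR m * (- a) ^ 3) with (INR m * a ^ 3) by ring.
  assert (0 <= INR m * a ^ 3) by (apply Rmult_le_pos; [|apply pow_le]; auto).
  assert (0 <= (x ^ 2 + (INR m + 1) * (2 * INR m + 1)) * (- a) ^ 2 * core (S m) x).
  { apply Rmult_le_pos; [apply Rmult_le_pos; [nra|apply pow2_ge_0]|lra]. }
  assert (0 <= (3 * INR m + 2) * x ^ 2 * a * core (S m) x ^ 2).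
  { repeat apply Rmult_le_pos; try apply pow_le; lra. }
  assert (0 < x ^ 4 * core (S m) x ^ 3) by (apply Rmult_lt_0_compat; apply pow_lt; lra).
  lra.
Qed.

(** * Derivatives of [bessel_f] up to order 4 and its determinant *)

Lemma locally_pos (x : R) : 0 < x -> locally x (fun y => 0 < y).
Proof. intros Hx; apply (open_gt 0), Hx. Qed.

Lemma Derive_n_chain (D : nat -> R -> R) (N : nat) :
  (forall k x, (k < N)%nat -> 0 < x -> is_derive (D k) x (D (S k) x)) ->
  forall k x, (k <= N)%nat -> 0 < x -> Derive_n (D 0%nat) k x = D k x.
Proof.
intros HD k; induction k as [|k IH]; intros x Hk Hx; [reflexivity|].
change (Derive (Derive_n (D 0%nat) k) x = D (S k) x).
rewrite (Derive_ext_loc _ (D k)).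
- apply is_derive_unique, HD; auto.
- apply filter_imp with (2 := locally_pos x Hx); intros y Hy; apply IH; auto; lia.
Qed.

(** Writing [k x^(k-1)] as [x^k * k / x] keeps [x^k] as a common factor of all derivatives,
    including [k = 0]. *)
Lemma is_derive_pow_mult_pos (k : nat) (F : R -> R) (x dF : R) : 0 < x ->
  is_derive F x dF ->
  is_derive (fun y => y ^ k * F y) x (x ^ k * (INR k * F x / x + dF)).
Proof.
intros Hx HF; auto_derive; [exists dF; exact HF|].
rewrite (is_derive_unique (fun y : R => F y) x dF HF); destruct k as [|k].
- simpl; field; lra.
- change (match k with 0%nat => 1 | S _ => INR k + 1 end) with (INR (S k)).
  simpl; field; lra.
Qed.

(** The derivative of order [k <= 4] of [bessel_f (S m)] without its factor [C x^(2m)], reduced to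
    [A] and [B] by the recurrence. Order 4 divides by [x] because [x^(2m-1)] is not a natural power
    when [m = 0]. *)
Definition bessel_f_derivative (m k : nat) (x : R) : R :=
  let A := core m x in
  let B := core (S m) x in
  let mu := INR m in
  match k with
  | 0%nat => x ^ 3 * B
  | 1%nat => x ^ 2 * A
  | 2%nat => x * (2 * (mu + 1) * A - x ^ 2 * B)
  | 3%nat => (2 * mu + 1) * 2 * (mu + 1) * A - 2 * (mu + 1) * x ^ 2 * B - x ^ 2 * A
  | _ => (2 * mu * (2 * mu + 1) * 2 * (mu + 1) * A - 2 * mu * 2 * (mu + 1) * x ^ 2 * B
          - (4 * mu + 4) * x ^ 2 * A + x ^ 4 * B) / x
  end.

Lemma is_derive_bessel_f_derivative (C : R) (m k : nat) (x : R) : (k < 4)%nat -> 0 < x ->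
  is_derive (fun y => y ^ (2 * m) * (C * bessel_f_derivative m k y)) x
    (x ^ (2 * m) * (C * bessel_f_derivative m (S k) x)).
Proof.
intros Hk Hx; evar_last.
- apply is_derive_pow_mult_pos; [exact Hx|apply Derive_correct].
  destruct k as [|[|[|[|k]]]]; [..|lia]; unfold bessel_f_derivative; auto_derive;
    repeat split; eexists; apply is_derive_core.
- f_equal; rewrite mult_INR; change (INR 2) with 2.
  (* The contribution [u] of the power is moved to the right, leaving the derivative [v] of the
     reduced factor to compute. *)
  match goal with |- ?u + ?v = ?w => assert (E : v = w - u); [|rewrite E; ring] end.
  apply is_derive_unique.
  destruct k as [|[|[|[|k]]]]; [..|lia]; unfold bessel_f_derivative; auto_derive;
    try (repeat split; eexists; apply is_derive_core);
    rewrite !Derive_core, !(core_recurrence m x); rewrite ?S_INR; field; lra.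
Qed.

Lemma Derive_n_bessel_f (m : nat) : exists C, 0 < C /\ forall k x, (k <= 4)%nat -> 0 < x ->
  Derive_n (bessel_f (S m)) k x = x ^ (2 * m) * (C * bessel_f_derivative m k x).
Proof.
destruct (bessel_f_core (S m)) as [C [HC Hf]]; exists C; split; auto.
intros k x Hk Hx.
rewrite (Derive_n_ext_loc _ (fun y => y ^ (2 * m) * (C * bessel_f_derivative m 0 y))).
- apply (Derive_n_chain (fun k y => y ^ (2 * m) * (C * bessel_f_derivative m k y)) 4); auto.
  intros i y; apply is_derive_bessel_f_derivative.
- apply filter_imp with (2 := locally_pos x Hx); intros y Hy; rewrite Hf by auto.
  replace (2 * S m + 1)%nat with (2 * m + 3)%nat by lia; rewrite pow_add; simpl; ring.
Qed.

Lemma w3_bessel_f (m : nat) : exists C, 0 < C /\ forall x, 0 < x ->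
  w3 (bessel_f (S m)) x = C * (x ^ (6 * m + 3) * reduced_w m x).
Proof.
destruct (Derive_n_bessel_f m) as [C [HC Hf]].
(* The determinant is cubic in the derivatives, whence [C ^ 3]; the factor [4 (m + 1)] splits off
   after cancellation. *)
exists (4 * (INR m + 1) * C ^ 3); split.
{ generalize (pos_INR m); intros; apply Rmult_lt_0_compat; [lra|apply pow_lt, HC]. }
intros x Hx; rewrite w3E; cbv zeta; rewrite !Hf by (auto; lia).
replace (6 * m + 3)%nat with (2 * m + 2 * m + 2 * m + 3)%nat by lia; rewrite !pow_add.
unfold bessel_f_derivative, reduced_w; field; lra.
Qed.

(** * First positive zeros *)

Lemma first_positive_zero_unique (g : R -> R) (a b : R) :
  is_first_positive_zero g a -> is_first_positive_zero g b -> a = b.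
Proof.
intros [Ha [Za Na]] [Hb [Zb Nb]].
destruct (Rtotal_order a b) as [H|[H|H]]; auto.
- exfalso; exact (Nb a Ha H Za).
- exfalso; exact (Na b Hb H Zb).
Qed.

Lemma j1_correct (g : R -> R) (a : R) : is_first_positive_zero g a -> j1 g = a.
Proof.
intros Ha; apply (first_positive_zero_unique g); auto.
apply (iota_correct (V := R_CompleteNormedModule) (is_first_positive_zero g)).
exists a; split; auto; intros b; apply (first_positive_zero_unique g); auto.
Qed.

(** The infimum of the positive zeros, taken as minus a least upper bound, is a zero by continuity
    and differs from 0 since [F 0 <> 0]. *)
Lemma first_positive_zero_exists (F : R -> R) (z : R) :
  (forall x, continuous F x) -> F 0 <> 0 -> 0 < z -> F z = 0 ->
  exists a, is_first_positive_zero F a.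
Proof.
intros Hc H0 Hz Fz.
destruct (completeness (fun y => 0 < - y /\ F (- y) = 0)) as [s [Ub Lb]].
{ exists 0; intros y [Hy _]; lra. }
{ exists (- z); rewrite Ropp_involutive; auto. }
assert (Hs : s <= 0) by (apply Lb; intros y [Hy _]; lra).
assert (Hbelow : forall x, 0 < x -> x < - s -> F x <> 0).
{ intros x Hx Hxs Fx; enough (- x <= s) by lra; apply Ub; rewrite Ropp_involutive; auto. }
assert (Fs : F (- s) = 0).
{ destruct (Req_dec (F (- s)) 0) as [E|N]; auto; exfalso.
  destruct (Hc (- s) (fun y => y <> 0)) as [e He]; [apply (open_neq 0), N|].
  assert (Hse : s <= s - e); [|generalize (cond_pos e); lra].
  apply Lb; intros y [Hy Fy]; apply Rnot_lt_le; intros Hlt.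
  apply (He (- y)); auto.
  assert (y <= s) by (apply Ub; auto).
  apply Rabs_def1; unfold minus, plus, opp; simpl; lra. }
exists (- s); repeat split; auto.
destruct Hs as [Hs|Hs]; [lra|].
exfalso; apply H0; rewrite <- Fs; f_equal; lra.
Qed.

Lemma core_first_positive_zero (n : nat) : exists a,
  is_first_positive_zero (core n) a /\ forall x, 0 < x < a -> 0 < core n x.
Proof.
assert (Hc : forall x, continuous (core n) x).
{ intros x; apply (ex_derive_continuous (core n)); eexists; apply is_derive_core. }
generalize (core_0_pos n); intros H0.
destruct (core_zeros_unbounded n 0) as [z [_ [Hz Zz]]].
destruct (first_positive_zero_exists (core n) z) as [a Ha]; auto; [lra|].
exists a; split; auto; intros x Hx; destruct Ha as [_ [_ Na]].
destruct (Rlt_or_le 0 (core n x)) as [H|H]; auto.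
exfalso; destruct H as [H|H]; [|apply (Na x); lra].
(* A negative value at [x] would force a zero between 0 and [x], before the first one. *)
destruct (IVT_gen (core n) 0 x 0) as [c [Hcx Zc]].
- intros y; apply continuity_pt_filterlim, Hc.
- rewrite Rmin_right, Rmax_left; lra.
- rewrite Rmin_left, Rmax_right in Hcx by lra.
  destruct (Req_dec c 0) as [->|Hc0]; [lra|apply (Na c); lra].
Qed.

Lemma is_first_positive_zero_ext (g h : R -> R) (a : R) :
  (forall x, 0 < x -> (g x = 0 <-> h x = 0)) ->
  is_first_positive_zero h a -> is_first_positive_zero g a.
Proof.
intros Hgh [Ha [Za Na]]; repeat split; auto.
- apply Hgh; auto.
- intros x Hx Hxa Hg; apply (Na x Hx Hxa), Hgh; auto.
Qed.

(** A positive factor does not move zeros, so [j1 g] is the first zero of [core n]. This serves [f']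
    with [core m] and [f] with [core (S m)]. *)
Lemma j1_pos_multiple (g P : R -> R) (n : nat) :
  (forall x, 0 < x -> 0 < P x /\ g x = P x * core n x) ->
  forall x, 0 < x < j1 g -> 0 < core n x.
Proof.
intros Hg; destruct (core_first_positive_zero n) as [a [Ha Hpos]].
rewrite (j1_correct g a); auto.
apply (is_first_positive_zero_ext g (core n)); auto.
intros x Hx; destruct (Hg x Hx) as [HP ->]; split.
- intros E; apply Rmult_integral in E; lra.
- intros ->; ring.
Qed.

Theorem corollary21 (n : nat) (hn : (1 <= n)%nat) :
  let f := bessel_f n in
  let v := fun x : R => powerRZ x (-3 * (Z.of_nat n - 1))%Z * w3 f x in
  increasing_on v 0 (j1 (Derive f)) /\
  positive_on v 0 (j1 (Derive f)) /\
  increasing_on (w3 f) 0 (j1 (Derive f)) /\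
  positive_on (w3 f) 0 (j1 (Derive f)) /\
  positive_on (w3 f) 0 (j1 f).
Proof.
destruct n as [|m]; [lia|]; intros f v.
destruct (w3_bessel_f m) as [C [HC Hw]]; fold f in Hw.
destruct (Derive_n_bessel_f m) as [C' [HC' Hf]]; fold f in Hf.
(* Up to the constant [C], this is [x^(-3m) w(f)], with [3 m = 3 (n - 1)]. *)
set (V := fun x => x ^ (3 * m + 3) * reduced_w m x).
assert (HwV : forall x, 0 < x -> w3 f x = x ^ (3 * m) * (C * V x)).
{ intros x Hx; rewrite Hw by auto; unfold V.
  replace (6 * m + 3)%nat with (3 * m + (3 * m + 3))%nat by lia; rewrite pow_add; ring. }
assert (Hv : forall x, 0 < x -> v x = C * V x).
{ intros x Hx; unfold v; rewrite HwV by auto.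
  replace (-3 * (Z.of_nat (S m) - 1))%Z with (- Z.of_nat (3 * m))%Z by lia.
  rewrite powerRZ_neg', <- pow_powerRZ; field; apply pow_nonzero; lra. }
assert (HA : forall x, 0 < x < j1 (Derive f) -> 0 < core m x).
{ apply (j1_pos_multiple _ (fun x => x ^ (2 * m) * (C' * x ^ 2))); intros x Hx; split.
  - apply Rmult_lt_0_compat; [|apply Rmult_lt_0_compat; auto]; apply pow_lt, Hx.
  - change (Derive f x) with (Derive_n f 1 x); rewrite Hf by (auto; lia); simpl; ring. }
assert (HB : forall x, 0 < x < j1 f -> 0 < core (S m) x).
{ apply (j1_pos_multiple _ (fun x => x ^ (2 * m) * (C' * x ^ 3))); intros x Hx; split.
  - apply Rmult_lt_0_compat; [|apply Rmult_lt_0_compat; auto]; apply pow_lt, Hx.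
  - change (f x) with (Derive_n f 0 x); rewrite Hf by (auto; lia); simpl; ring. }
assert (HV : forall x, 0 < x -> x < j1 (Derive f) -> 0 < V x).
{ intros x Hx Hxj; apply Rmult_lt_0_compat; [apply pow_lt, Hx|].
  apply reduced_w_pos; auto; intros z Hz; apply HA; lra. }
assert (HVlt : forall x y, 0 < x -> x < y -> y < j1 (Derive f) -> V x < V y).
{ intros x y Hx Hxy Hy; apply reduced_w_increasing; [lra|auto|].
  intros z Hz; apply HA; lra. }
repeat split.
- intros x y Hx Hxy Hy; rewrite !Hv by lra.
  apply Rmult_lt_compat_l; auto.
- intros x Hx Hxj; rewrite Hv by auto; apply Rmult_lt_0_compat; auto.
- intros x y Hx Hxy Hy; rewrite !HwV by lra.
  (* The power grows only weakly when [m = 0]; strictness comes from [V]. *)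
  apply Rle_lt_trans with (y ^ (3 * m) * (C * V x)).
  + apply Rmult_le_compat_r; [|apply pow_incr; lra].
    left; apply Rmult_lt_0_compat; auto; apply HV; lra.
  + apply Rmult_lt_compat_l; [apply pow_lt; lra|apply Rmult_lt_compat_l; auto].
- intros x Hx Hxj; rewrite HwV by auto.
  apply Rmult_lt_0_compat; [apply pow_lt, Hx|apply Rmult_lt_0_compat; auto].
- intros x Hx Hxj; rewrite Hw by auto.
  apply Rmult_lt_0_compat; auto; apply Rmult_lt_0_compat; [apply pow_lt, Hx|].
  apply reduced_w_pos_before_zero; auto; intros z Hz; apply HB; lra.
Qed.
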